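(* Let $G=G(I,P;E)$ be an Assur graph such that $G$ and the graph $G^*$ obtained by identifying all pinned vertices to one vertex are planar. Then there is a configuration $\mathbf p$ of $I\cup P$ in $\mathbb R^2$ (with distinct positions for the pinned vertices) such that: (1) the pinned framework $G(\mathbf p)$ has a one-dimensional space of self-stresses, spanned by a self-stress which is non-zero on every edge; and (2) $G(\mathbf p)$ has, up to scalar multiples, a unique non-trivial first-order motion (with the pinned vertices fixed), and this motion assigns a non-zero velocity to every inner vertex.
   Context: A pinned graph $G(I,P;E)$ has a set $I$ of inner vertices, a set $P$ of pinned vertices, and edge set $E$ in which every edge has at least one endpoint in $I$. A pinned framework $G(\mathbf p)$ places all vertices at points of $\mathbb R^2$, pinned vertices regarded as fixed. A first-order motion assigns $\mathbf p'_i\in\mathbb R^2$ to inner vertices ($\mathbf p'_v=\mathbf 0$ for $v\in P$) with $(\mathbf p_i-\mathbf p_j)\cdot(\mathbf p'_i-\mathbf p'_j)=0$ for all edges $ij$. A self-stress is an assignment of scalars $\lambda_{ij}$ to edges with $\sum_{j:ij\in E}\lambda_{ij}(\mathbf p_i-\mathbf p_j)=\mathbf 0$ at every inner vertex $i$ (a row dependency of the $|E|\times 2|I|$ pinned rigidity matrix). Pinned Framework Conditions: $|E|=2|I|$ and for every subgraph $G'(I',P';E')$ with $E'\ne\emptyset$: $|E'|\le 2|I'|$ if $|P'|\ge2$, $|E'|\le 2|I'|-1$ if $|P'|=1$, $|E'|\le 2|I'|-3$ if $P'=\emptyset$; graphs satisfying these are called pinned isostatic. A rigidity circuit is a (multi)graph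 with edge set $C$, $|C|=2|V(C)|-2$, and every nonempty proper subset $F$ satisfies $|F|\le 2|V(F)|-3$. An Assur graph is a pinned isostatic graph such that identifying all pinned vertices to a single vertex (keeping all edges) yields a rigidity circuit. *)

(* Defs.v *)
From Stdlib Require Import Reals.
From mathcomp Require Import all_boot.

Set Implicit Arguments.
Unset Strict Implicit.
Unset Printing Implicit Defensive.

(* A (multi)graph is given by a finite vertex type [V], a finite edge type [E]
   and the endpoint map [ends : E -> V * V]. *)

Definition pt := (R * R)%type.

Definition other {V : eqType} (uv : V * V) (i : V) : V :=
  if uv.1 == i then uv.2 else uv.1.

(* G(I,P;E): pinned vertices P, inner vertices I = ~: P.
   Every edge joins two distinct vertices, at least one of them inner. *)
Definition pinned_graph (V E : finType) (P : {set V}) (ends : E -> V * V) : Prop :=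
  forall e, (ends e).1 != (ends e).2 /\ ((ends e).1 \notin P \/ (ends e).2 \notin P).

(* Pinned Framework Conditions (pinned isostatic). A subgraph G'(I',P';E')
   has I' inner, P' pinned vertices, and edges E' whose endpoints lie in I' u P'. *)
Definition pinned_isostatic (V E : finType) (P : {set V}) (ends : E -> V * V) : Prop :=
  #|E| = 2 * #|~: P| /\
  forall (I' P' : {set V}) (F : {set E}),
    I' \subset ~: P -> P' \subset P -> F != set0 ->
    (forall e, e \in F -> (ends e).1 \in I' :|: P' /\ (ends e).2 \in I' :|: P') ->
    (2 <= #|P'| -> #|F| <= 2 * #|I'|) /\
    (#|P'| = 1 -> #|F| + 1 <= 2 * #|I'|) /\
    (#|P'| = 0 -> #|F| + 3 <= 2 * #|I'|).

Definition span_of (W E : finType) (ends : E -> W * W) (F : {set E}) : {set W} :=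
  [set w | [exists e in F, ((ends e).1 == w) || ((ends e).2 == w)]].

(* Rigidity circuit: the multigraph with edge set C (= all of E) satisfies
   |C| = 2|V(C)| - 2 and every nonempty proper F has |F| <= 2|V(F)| - 3
   (written without truncated subtraction). *)
Definition rigidity_circuit (W E : finType) (ends : E -> W * W) : Prop :=
  #|E| + 2 = 2 * #|span_of ends setT| /\
  forall F : {set E}, F != set0 -> F \proper setT ->
    #|F| + 3 <= 2 * #|span_of ends F|.

(* G^*: identify all pinned vertices to a single vertex [None];
   inner vertex v becomes [Some v]. Edges are kept (multigraph). *)
Definition star_vertex (V : finType) (P : {set V}) := option {v : V | v \notin P}.

Definition collapse (V : finType) (P : {set V}) (v : V) : star_vertex P := insub v.

Definition star_ends (V E : finType) (P : {set V}) (ends : E -> V * V)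
  (e : E) : star_vertex P * star_vertex P :=
  (collapse P (ends e).1, collapse P (ends e).2).

Definition assur_graph (V E : finType) (P : {set V}) (ends : E -> V * V) : Prop :=
  pinned_graph P ends /\ pinned_isostatic P ends /\ rigidity_circuit (star_ends P ends).

Definition planar (W E : finType) (ends : E -> W * W) : Prop :=
  exists (pos : W -> pt) (arc : E -> R -> pt),
    injective pos /\
    (forall e,
        continuity (fun t => fst (arc e t)) /\ continuity (fun t => snd (arc e t)) /\
        arc e R0 = pos (ends e).1 /\ arc e R1 = pos (ends e).2 /\
        (forall s t, Rle R0 s /\ Rle s R1 -> Rle R0 t /\ Rle t R1 -> arc e s = arc e t -> s = t) /\
        (forall t w, Rlt R0 t /\ Rlt t R1 -> arc e t <> pos w)) /\
    (forall e f, e <> f -> forall s t, Rlt R0 s /\ Rlt s R1 -> Rlt R0 t /\ Rlt t R1 ->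
        arc e s <> arc f t).

Definition dot (a b : pt) : R := Rplus (Rmult (fst a) (fst b)) (Rmult (snd a) (snd b)).
Definition vsub (a b : pt) : pt := (Rminus (fst a) (fst b), Rminus (snd a) (snd b)).

Definition first_order_motion (V E : finType) (P : {set V}) (ends : E -> V * V)
  (p m : V -> pt) : Prop :=
  (forall v, v \in P -> m v = (R0, R0)) /\
  (forall e, dot (vsub (p (ends e).1) (p (ends e).2))
                 (vsub (m (ends e).1) (m (ends e).2)) = R0).

Definition self_stress (V E : finType) (P : {set V}) (ends : E -> V * V)
  (p : V -> pt) (w : E -> R) : Prop :=
  forall i, i \notin P ->
    \big[Rplus/R0]_(e | ((ends e).1 == i) || ((ends e).2 == i))
        Rmult (w e) (fst (vsub (p i) (p (other (ends e) i)))) = R0 /\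
    \big[Rplus/R0]_(e | ((ends e).1 == i) || ((ends e).2 == i))
        Rmult (w e) (snd (vsub (p i) (p (other (ends e) i)))) = R0.

(* Main.v *)
(** Collapse all pins to the origin and place the inner vertices generically at [m].
    Since [G^*] is a rigidity circuit, removing any one edge leaves a Laman graph, so
    every proper subset of the rows of the pinned rigidity matrix is independent: the
    self-stress is unique and nowhere zero. The motion condition
    [(p i - p j) . (m i - m j) = 0] is symmetric in [p] and [m], so [m] is a pinned
    motion of every [p] that is a motion of the framework [m] with its pins set free.
    One such [p] is the rotation [m^perp], which keeps the pins together; another is a
    [q] separating the pins, because the velocities of the free pins only have to
    annihilate the reactions of the single self-stress, which is one linear condition.
    Independence of all rows but one persists from [m^perp] to [m^perp + t q] for all
    but finitely many [t]; there [m] and the resulting self-stress span the kernels. *)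

Require Import Defs.
From Stdlib Require Import Reals FunctionalExtensionality Classical.
From mathcomp Require Import all_boot all_order all_algebra.
From mathcomp Require Import ring lra zify Rstruct.

Set Implicit Arguments.
Unset Strict Implicit.
Unset Printing Implicit Defensive.

Import Order.TTheory GRing.Theory Num.Theory.

Local Open Scope ring_scope.

(** * Matrices indexed by finite types *)

(** Applied to the transpose [fun c e => A e c], this is the right kernel; motions are treated that
    way below. *)
Definition left_kernel (F : fieldType) (E C : finType) (A : E -> C -> F)
    (w : E -> F) : Prop :=
  forall c, \sum_e w e * A e c = 0.

Definition rows_free (F : fieldType) (E C : finType) (A : E -> C -> F) : Prop :=
  forall w, left_kernel A w -> forall e, w e = 0.

Definition fmx (F : fieldType) (E C : finType) (A : E -> C -> F) :
    'M[F]_(#|E|, #|C|) :=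
  \matrix_(i, j) A (enum_val i) (enum_val j).

Lemma sum_enum_rank (F : fieldType) (E : finType) (f : 'I_#|E| -> F) :
  \sum_i f i = \sum_e f (enum_rank e).
Proof. exact: (reindex _ (onW_bij _ (enum_rank_bij E))). Qed.

Lemma left_kernelP (F : fieldType) (E C : finType) (A : E -> C -> F) (w : E -> F) :
  left_kernel A w <-> (\row_(i < #|E|) w (enum_val i)) *m fmx A = 0.
Proof.
split=> [w0|/matrixP w0 c].
  apply/matrixP=> i j; rewrite !mxE sum_enum_rank -[RHS](w0 (enum_val j)).
  by apply: eq_bigr => e _; rewrite !mxE enum_rankK.
have := w0 0 (enum_rank c); rewrite !mxE sum_enum_rank => {2}<-.
by apply: eq_bigr => e _; rewrite !mxE !enum_rankK.
Qed.

Lemma left_kernel_row (F : fieldType) (E C : finType) (A : E -> C -> F)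
    (v : 'rV[F]_#|E|) :
  v *m fmx A = 0 -> left_kernel A (fun e => v 0 (enum_rank e)).
Proof.
move=> v0; apply/left_kernelP; rewrite -[RHS]v0; congr (_ *m _).
by apply/rowP=> i; rewrite mxE enum_valK.
Qed.

Lemma rows_freeP (F : fieldType) (E C : finType) (A : E -> C -> F) :
  rows_free A <-> row_free (fmx A).
Proof.
split=> [A_free|A_free w /left_kernelP w0 e].
  apply: inj_row_free => v /left_kernel_row/A_free v0.
  by apply/rowP=> i; rewrite mxE -(v0 (enum_val i)) enum_valK.
have /matrixP/(_ 0 (enum_rank e)) : \row_(i < #|E|) w (enum_val i) = 0.
  by apply: (row_free_inj A_free); rewrite w0 mul0mx.
by rewrite !mxE enum_rankK.
Qed.

(** With a right inverse [N] of [A], the determinant of [(A + t B) N] is a polynomial in [t] with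
    value 1 at 0, and the rows are free wherever it does not vanish. *)
Lemma rows_free_line (F : fieldType) (E C : finType) (A B : E -> C -> F) :
  rows_free A ->
  exists f : {poly F}, f.[0] != 0 /\
    forall t, f.[t] != 0 -> rows_free (fun e c => A e c + t * B e c).
Proof.
case/rows_freeP/row_freeP => N AN1.
pose M : 'M[{poly F}]_#|E| := map_mx polyC (fmx A *m N) + 'X *: map_mx polyC (fmx B *m N).
have Mt t : (\det M).[t] = \det ((fmx A + t *: fmx B) *m N).
  rewrite -horner_evalE -det_map_mx; congr (\det _).
  rewrite mulmxDl -scalemxAl; apply/matrixP=> i j.
  by rewrite !mxE /= /horner_eval !hornerE.
exists (\det M); split=> [|t]; first by rewrite Mt scale0r addr0 AN1 det1 oner_neq0.
rewrite Mt => dt; apply/rows_freeP.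
have -> : fmx (fun e c => A e c + t * B e c) = fmx A + t *: fmx B.
  by apply/matrixP=> i j; rewrite !mxE.
have : row_free ((fmx A + t *: fmx B) *m N) by rewrite row_free_unit unitmxE unitfE.
rewrite -!kermx_eq0 -!submx0 => /(submx_trans _); apply.
by apply/sub_kermxP; rewrite mulmxA mulmx_ker mul0mx.
Qed.

(** Fredholm alternative: the columns of the cokernel of the transpose are left kernel vectors of
    [A], so [b] lies in the column space. *)
Lemma linear_system_solvable (F : fieldType) (E C : finType) (A : E -> C -> F)
    (b : E -> F) :
  (forall w, left_kernel A w -> \sum_e w e * b e = 0) ->
  exists x : C -> F, forall e, \sum_c A e c * x c = b e.
Proof.
move=> kerb; pose bv := \row_(i < #|E|) b (enum_val i).
have /submxP[D bD] : (bv <= (fmx A)^T)%MS.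
  rewrite submxE; apply/eqP/rowP=> j; rewrite mxE [RHS]mxE sum_enum_rank.
  pose K := cokermx (fmx A)^T.
  rewrite -[RHS](kerb (fun e => K (enum_rank e) j)).
    by apply: eq_bigr => e _; rewrite mxE enum_rankK mulrC.
  move=> c; have /matrixP/(_ (enum_rank c) j) := mulmx_coker (fmx A)^T.
  rewrite mxE [RHS]mxE sum_enum_rank => {2}<-.
  by apply: eq_bigr => e _; rewrite !mxE !enum_rankK mulrC.
exists (fun c => D 0 (enum_rank c)) => e.
have /matrixP/(_ 0 (enum_rank e)) := bD; rewrite !mxE enum_rankK sum_enum_rank => ->.
by apply: eq_bigr => c _; rewrite !mxE !enum_rankK mulrC.
Qed.

(** A square matrix with a nonzero right kernel vector is singular. This is how a motion produces a
    self-stress. *)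
Lemma square_left_kernel (F : fieldType) (E C : finType) (A : E -> C -> F)
    (x : C -> F) (c : C) :
  #|E| = #|C| -> left_kernel (fun c e => A e c) x -> x c != 0 ->
  exists2 w, left_kernel A w & exists e, w e != 0.
Proof.
move=> cEC kx xc; apply: NNPP => now.
have : rows_free A.
  move=> w kw e; apply/eqP; apply/negPn/negP => we.
  by apply: now; exists w => //; exists e.
move=> /rows_freeP/eqP rkA.
have /rows_freeP/(_ _ kx c)/eqP : row_free (fmx (fun c e => A e c)).
  have -> : fmx (fun c e => A e c) = (fmx A)^T by apply/matrixP=> i j; rewrite !mxE.
  by rewrite /row_free mxrank_tr rkA cEC.
by rewrite (negbTE xc).
Qed.

(** Both kernels of a square matrix have the same dimension, so a left kernel inside a line bounds
    the right kernel by a line. This turns uniqueness of the stress into uniqueness of the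
    motion. *)
Lemma square_right_kernel (F : fieldType) (E C : finType) (A : E -> C -> F)
    (w0 : E -> F) :
  #|E| = #|C| ->
  (forall w, left_kernel A w -> exists k, forall e, w e = k * w0 e) ->
  forall x y c, left_kernel (fun c e => A e c) x -> left_kernel (fun c e => A e c) y ->
    x c != 0 -> exists k, forall c, y c = k * x c.
Proof.
move=> cEC kA x y c /left_kernelP kx /left_kernelP ky xc.
have trA : fmx (fun c e => A e c) = (fmx A)^T by apply/matrixP=> i j; rewrite !mxE.
rewrite trA in kx ky.
have rk1 : (\rank (kermx (fmx A)) <= 1)%N.
  have : (kermx (fmx A) <= \row_(i < #|E|) w0 (enum_val i))%MS.
    apply/row_subP=> i; have : row i (kermx (fmx A)) *m fmx A = 0.
      by rewrite -row_mul mulmx_ker row0.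
    move=> /left_kernel_row/kA[k wk]; apply/sub_rVP; exists k.
    by apply/rowP=> j; rewrite [RHS]mxE [X in _ * X]mxE -wk enum_valK.
  by move/mxrankS/leq_trans; apply; rewrite rank_leq_row.
have rkT : (\rank (kermx (fmx A)^T) <= 1)%N.
  by move: rk1 cEC; rewrite !mxrank_ker mxrank_tr; lia.
set xv := \row_(i < #|C|) x (enum_val i) in kx; set yv := \row_(i < #|C|) y (enum_val i) in ky.
have xker : (xv <= kermx (fmx A)^T)%MS by apply/sub_kermxP.
have yker : (yv <= kermx (fmx A)^T)%MS by apply/sub_kermxP.
have xv0 : xv != 0.
  by apply: contraNneq xc => /matrixP/(_ 0 (enum_rank c)); rewrite !mxE enum_rankK => ->.
have kerx : (kermx (fmx A)^T <= xv)%MS.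
  by rewrite -(geq_leqif (mxrank_leqif_sup xker)) rank_rV xv0.
have /sub_rVP[k yk] := submx_trans yker kerx.
exists k => c'; have /matrixP/(_ 0 (enum_rank c')) := yk.
by rewrite !mxE enum_rankK.
Qed.

(** * Generic placements *)

Definition move (F : fieldType) (W : Type) (p d : W -> bool -> F) (t : F) :
    W -> bool -> F :=
  fun v b => p v b + t * d v b.

(* A property holding at [p] holds at all but finitely many points of each line
   through [p]; this replaces Zariski openness. *)
Definition line_open (F : fieldType) (W : Type) (Q : (W -> bool -> F) -> Prop) : Prop :=
  forall p d, Q p ->
  exists f : {poly F}, f.[0] != 0 /\ forall t, f.[t] != 0 -> Q (move p d t).

(** The product of the finitely many polynomials serves for the conjunction. *)
Lemma line_open_all (F : fieldType) (W : Type) (I : eqType) (s : seq I)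
    (Q : I -> (W -> bool -> F) -> Prop) :
  (forall i, line_open (Q i)) -> line_open (fun p => forall i, i \in s -> Q i p).
Proof.
move=> openQ p d; elim: s => [|i s IHs] Qp.
  by exists 1; rewrite hornerE oner_neq0.
have [f [f0 fQ]] : exists f : {poly F}, f.[0] != 0 /\
    forall t, f.[t] != 0 -> forall i, i \in s -> Q i (move p d t).
  by apply: IHs => j js; apply: Qp; rewrite inE js orbT.
have [g [g0 gQ]] := openQ i p d (Qp i (mem_head _ _)).
exists (f * g); split=> [|t]; rewrite hornerM mulf_eq0 negb_or; first by rewrite f0.
by case/andP=> ft gt j /predU1P[->|]; [exact: gQ | exact: fQ].
Qed.

(** In characteristic zero the naturals below [size f] are distinct and outnumber the possible
    roots. *)
Lemma poly_nonroot (F : numFieldType) (f : {poly F}) :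
  f != 0 -> exists t, f.[t] != 0.
Proof.
move=> f0; apply: NNPP => noroot.
have := max_poly_roots (rs := [seq i%:R | i <- iota 0 (size f)]) f0.
rewrite size_map size_iota ltnn; move=> H; apply: notF; apply: H.
  by apply/allP=> t _; apply/negPn/negP => ft; apply: noroot; exists t.
by rewrite map_inj_uniq ?iota_uniq //; apply: mulrIn; exact: oner_neq0.
Qed.

(** On the line through [p1] and [p2], each property excludes only finitely many points. The
    substitution of [1 - 'X] expresses the second polynomial in the parameter that starts at
    [p1]. *)
Lemma line_open_meet (F : numFieldType) (W : Type) (Q1 Q2 : (W -> bool -> F) -> Prop) :
  line_open Q1 -> line_open Q2 -> ex Q1 -> ex Q2 -> exists p, Q1 p /\ Q2 p.
Proof.
move=> open1 open2 [p1 Qp1] [p2 Qp2].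
have [f [f0 fQ]] := open1 p1 (fun v b => p2 v b - p1 v b) Qp1.
have [g [g0 gQ]] := open2 p2 (fun v b => p1 v b - p2 v b) Qp2.
have fn0 : f != 0 by apply: contraNneq f0 => ->; rewrite horner0.
have gn0 : g \Po (1 - 'X) != 0.
  apply: contraNneq g0 => h0; have : (g \Po (1 - 'X)).[1] = 0 by rewrite h0 horner0.
  by rewrite horner_comp !hornerE subrr => ->.
have [t] := poly_nonroot (mulf_neq0 fn0 gn0).
rewrite hornerM horner_comp !hornerE mulf_eq0 negb_or => /andP[/fQ Q1t /gQ Q2t].
exists (move p1 (fun v b => p2 v b - p1 v b) t); split=> //.
congr (Q2 _): Q2t; apply: functional_extensionality => v.
by apply: functional_extensionality => b; rewrite /move; ring.
Qed.

Lemma line_open_meet_all (F : numFieldType) (W : Type) (I : finType)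
    (Q : I -> (W -> bool -> F) -> Prop) :
  (forall i, line_open (Q i)) -> (forall i, ex (Q i)) -> exists p, forall i, Q i p.
Proof.
move=> openQ exQ.
suff [p Qp] : exists p, forall i, i \in enum I -> Q i p.
  by exists p => i; apply: Qp; rewrite mem_enum.
elim: (enum I) => [|i s IHs]; first by exists (fun _ _ => 0).
have [p [Qip Qsp]] := line_open_meet (openQ i) (line_open_all (s := s) openQ) (exQ i) IHs.
by exists p => j /predU1P[->|] //; exact: Qsp.
Qed.

(** Twice the signed area of the triangle [x y z], with [true] for the first coordinate; it vanishes
    exactly when the points are collinear. *)
Definition cross (F : fieldType) (W : Type) (p : W -> bool -> F) (x y z : W) : F :=
  (p y true - p x true) * (p z false - p x false)
  - (p y false - p x false) * (p z true - p x true).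

Lemma cross_line_open (F : fieldType) (W : Type) (x y z : W) :
  line_open (fun p : W -> bool -> F => cross p x y z != 0).
Proof.
move=> p d pn0.
pose L v b : {poly F} := (p v b)%:P + 'X * (d v b)%:P.
exists ((L y true - L x true) * (L z false - L x false)
        - (L y false - L x false) * (L z true - L x true)).
split=> [|t]; rewrite /L !hornerE; last by [].
by rewrite ?mul0r ?addr0.
Qed.

Lemma neq_line_open (F : fieldType) (W : Type) (x y : W) :
  line_open (fun p : W -> bool -> F => p x <> p y).
Proof.
move=> p d pn0.
have [b pb] : exists b, p x b != p y b.
  apply: NNPP => nb; apply: pn0; apply: functional_extensionality => b.
  by apply/eqP/negPn/negP => pb; apply: nb; exists b.
exists (((p x b)%:P + 'X * (d x b)%:P) - ((p y b)%:P + 'X * (d y b)%:P)).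
split=> [|t]; rewrite !hornerE; first by rewrite ?mul0r ?addr0 subr_eq0.
by rewrite subr_eq0 => /eqP pt e; apply: pt; move/(congr1 (fun h => h b)): e.
Qed.

Lemma cross_generic (F : numFieldType) (W : eqType) (x y z : W) :
  x != y -> x != z -> y != z -> exists p : W -> bool -> F, cross p x y z != 0.
Proof.
move=> xy xz yz.
exists (fun v (b : bool) => if v == y then b%:R else if v == z then (~~ b)%:R else 0).
rewrite /cross !eqxx (negbTE xy) (negbTE xz) [z == y]eq_sym (negbTE yz) /=.
by rewrite !subr0 mulr1 mul0r subr0 oner_neq0.
Qed.

(** * Sparse graphs *)

Definition inside (W E : finType) (ends : E -> W * W) (D : {set E}) (X : {set W}) :
    {set E} :=
  [set e in D | ((ends e).1 \in X) && ((ends e).2 \in X)].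

Definition edges_at (W E : finType) (ends : E -> W * W) (D : {set E}) (v : W) :
    {set E} :=
  [set e in D | ((ends e).1 == v) || ((ends e).2 == v)].

(** Laman's count on vertex sets. A single vertex would violate the inequality, hence the bound on
    [#|X|] and the separate exclusion of loops. *)
Definition sparse (W E : finType) (ends : E -> W * W) (D : {set E}) : Prop :=
  (forall e, e \in D -> (ends e).1 != (ends e).2) /\
  forall X : {set W}, (1 < #|X|)%N -> (#|inside ends D X| + 3 <= 2 * #|X|)%N.

Definition joins (W : Type) (uv : W * W) (v a : W) : Prop :=
  uv = (v, a) \/ uv = (a, v).

Lemma inside_sub (W E : finType) (ends : E -> W * W) (D D' : {set E}) (X X' : {set W}) :
  D \subset D' -> X \subset X' -> inside ends D X \subset inside ends D' X'.
Proof.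
move=> /subsetP DD /subsetP XX; apply/subsetP=> e; rewrite !inE.
by case/and3P=> /DD -> /XX -> /XX ->.
Qed.

Lemma sparse_sub (W E : finType) (ends : E -> W * W) (D D' : {set E}) :
  D \subset D' -> sparse ends D' -> sparse ends D.
Proof.
move=> DD [loopless cnt]; split=> [e /(subsetP DD)|X X1]; first exact: loopless.
by apply: leq_trans (cnt X X1); rewrite leq_add2r subset_leq_card // inside_sub.
Qed.

Lemma joins_endpoint (W E : finType) (ends : E -> W * W) (D : {set E}) (v : W) (e : E) :
  sparse ends D -> e \in edges_at ends D v ->
  exists2 a, joins (ends e) v a & a != v.
Proof.
case=> loopless _; rewrite inE => /andP[/loopless].
case: (ends e) => x y /= xy /orP[]/eqP <-.
  by exists y; [left | rewrite eq_sym].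
by exists x; [right |].
Qed.

Lemma joins_inside (W E : finType) (ends : E -> W * W) (D : {set E}) (X : {set W})
    (v a : W) (e : E) :
  joins (ends e) v a -> e \in D -> v \in X -> a \in X -> e \in inside ends D X.
Proof. by rewrite inE => -[] -> -> /= -> ->. Qed.

Lemma sparse_simple (W E : finType) (ends : E -> W * W) (D : {set E}) (v a b : W)
    (e f : E) :
  sparse ends D -> e \in D -> f \in D -> e != f -> a != v ->
  joins (ends e) v a -> joins (ends f) v b -> a != b.
Proof.
move=> [_ cnt] eD fD ef av je jf; apply/eqP=> ab; rewrite -ab in jf.
have vX : v \in [set v; a] by rewrite !inE eqxx.
have aX : a \in [set v; a] by rewrite !inE eqxx orbT.
have := cnt [set v; a]; rewrite cards2 eq_sym av => /(_ isT).
have : [set e; f] \subset inside ends D [set v; a].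
  by apply/subsetP=> g /set2P[]->; [apply: joins_inside je _ _ _ | apply: joins_inside jf _ _ _].
by move/subset_leq_card; rewrite cards2 ef; lia.
Qed.

(** The degrees sum to [2 * #|D|], which sparsity keeps below four times the number of non-isolated
    vertices. *)
Lemma low_degree_vertex (W E : finType) (ends : E -> W * W) (D : {set E}) :
  sparse ends D -> D != set0 ->
  exists v, (0 < #|edges_at ends D v| <= 3)%N.
Proof.
move=> [loopless cnt] /set0Pn[e0 e0D]; apply: NNPP => high.
pose S := [set v | (0 < #|edges_at ends D v|)%N].
have inS e : e \in D -> ((ends e).1 \in S) && ((ends e).2 \in S).
  by move=> eD; rewrite !inE !card_gt0; apply/andP; split; apply/set0Pn; exists e;
    rewrite !inE eD eqxx ?orbT.
have S1 : (1 < #|S|)%N.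
  have /andP[S0 S0'] := inS _ e0D.
  have : [set (ends e0).1; (ends e0).2] \subset S by apply/subsetP=> v /set2P[]->.
  by move/subset_leq_card; rewrite cards2 (loopless _ e0D).
have DS : D \subset inside ends D S.
  by apply/subsetP=> e eD; rewrite inE eD; apply: inS.
have := cnt _ S1; have := subset_leq_card DS.
suff : (4 * #|S| <= 2 * #|D|)%N by lia.
have -> : (4 * #|S| = \sum_(v in S) 4)%N by rewrite sum_nat_const mulnC.
apply: (@leq_trans (\sum_(v in S) #|edges_at ends D v|)).
  apply: leq_sum => v; rewrite inE => v0; rewrite ltnNge; apply/negP=> v3.
  by apply: high; exists v; rewrite v0.
apply: (@leq_trans (\sum_v \sum_(e in D) (((ends e).1 == v) || ((ends e).2 == v)))).
  rewrite big_mkcond; apply: leq_sum => v _; case: ifP => // _.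
  rewrite -sum1_card big_mkcond [X in (_ <= X)%N]big_mkcond.
  by apply: leq_sum => e _; rewrite inE; case: (e \in D); case: (_ || _).
rewrite exchange_big /= mulnC -sum_nat_const; apply: leq_sum => e _.
have : (\sum_v (((ends e).1 == v) || ((ends e).2 == v)) = #|[set (ends e).1; (ends e).2]|)%N.
  rewrite -sum1_card [RHS]big_mkcond; apply: eq_bigr => v _.
  by rewrite !inE ![v == _]eq_sym; case: (_ || _).
by move=> ->; rewrite cards2; case: (_ != _).
Qed.

(** Supermodularity of the induced edge count: edges between [X] and [Y] are gained only by the
    union. *)
Lemma inside_UI (W E : finType) (ends : E -> W * W) (D : {set E}) (X Y : {set W}) :
  (#|inside ends D X| + #|inside ends D Y|
    <= #|inside ends D (X :|: Y)| + #|inside ends D (X :&: Y)|)%N.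
Proof.
rewrite -cardsUI; apply: leq_add; apply: subset_leq_card.
  by rewrite subUset !inside_sub // ?subsetUl ?subsetUr.
by apply/subsetP=> e; rewrite !inE => /andP[/and3P[-> -> ->] /and3P[_ -> ->]].
Qed.

Lemma inside_small (W E : finType) (ends : E -> W * W) (D : {set E}) (X Y : {set W}) :
  sparse ends D -> (#|X :&: Y| <= 1)%N ->
  inside ends D X :&: inside ends D Y = set0.
Proof.
move=> [loopless _] XY; apply/setP=> e; rewrite !inE; apply/negP.
case/andP=> /and3P[eD X1 X2] /and3P[_ Y1 Y2].
have := loopless _ eD; apply/negP/negPn/eqP.
by apply: (card_le1_eqP XY); rewrite inE ?X1 ?X2.
Qed.

Lemma cardsI_gt1 (W : finType) (X Y : {set W}) (a b : W) :
  a != b -> a \in X -> a \in Y -> b \in X -> b \in Y -> (1 < #|X :&: Y|)%N.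
Proof.
move=> ab aX aY bX bY.
have : [set a; b] \subset X :&: Y by apply/subsetP=> x /set2P[]->; rewrite inE ?aX ?bX.
by move/subset_leq_card; rewrite cards2 ab.
Qed.

(** * Reduction at a vertex of degree three *)

Section DegreeThree.

Variables (W E : finType) (ends : E -> W * W) (D : {set E}) (v : W).
Variables (ea eb ec : E) (a b c : W).
Hypotheses (spD : sparse ends D) (atv : edges_at ends D v = [set ea; eb; ec]).
Hypotheses (ja : joins (ends ea) v a) (jb : joins (ends eb) v b) (jc : joins (ends ec) v c).
Hypotheses (ab : a != b) (ac : a != c) (av : a != v) (bv : b != v).
Hypotheses (eab : ea != eb) (ebc : eb != ec) (eac : ea != ec).

Let D' := D :\: edges_at ends D v.

(** Without [v], such an [X] already spans at least [2 * #|X| - 3] edges, so no further edge may be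
    added inside it. *)
Let tight (X : {set W}) := (2 * #|X| < #|inside ends D' X| + 4)%N.

Let spD' : sparse ends D'.
Proof. exact: sparse_sub (subsetDl _ _) spD. Qed.

Let insideD'_v (X : {set W}) : inside ends D' X = inside ends D' (X :\ v).
Proof.
apply/setP=> e; rewrite !inE; case: (e \in D) => //=; rewrite ?andbF ?andbT //=.
by case: ((ends e).1 == v); case: ((ends e).2 == v).
Qed.

(** [D'] has no edge at [v], so deleting [v] from [X] would keep all edges and overfill the
    remaining set. *)
Let tight_notin (X : {set W}) (x y : W) :
  x != y -> x != v -> y != v -> x \in X -> y \in X -> tight X -> v \notin X.
Proof.
move=> xy xv yv xX yX; rewrite /tight insideD'_v => tX; apply/negP=> vX.
have X1 : (1 < #|X :\ v|)%N.
  have : [set x; y] \subset X :\ v.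
    by apply/subsetP=> z /set2P[]->; rewrite !inE ?xv ?yv.
  by move/subset_leq_card; rewrite cards2 xy.
by move: tX (spD'.2 _ X1); rewrite (cardsD1 v X) vX; clear; lia.
Qed.

(** Adding [v] brings three edges but allows only two more, which would break sparsity of [D]. *)
Let not_tight3 (X : {set W}) : a \in X -> b \in X -> c \in X -> ~ tight X.
Proof.
move=> aX bX cX tX; have vX := tight_notin ab av bv aX bX tX.
have v1 : v \in v |: X by rewrite !inE eqxx.
have sub x : x \in X -> x \in v |: X by move=> xX; rewrite inE xX orbT.
have star3 : edges_at ends D v \subset inside ends D (v |: X).
  have inD : edges_at ends D v \subset D by apply/subsetP=> e; rewrite inE => /andP[].
  apply/subsetP=> e ev; have eD := subsetP inD e ev.
  have : [|| e == ea, e == eb | e == ec] by move: ev; rewrite atv !inE -orbA.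
  case/or3P=> /eqP ee; rewrite ee in eD *.
  - exact: joins_inside ja eD v1 (sub _ aX).
  - exact: joins_inside jb eD v1 (sub _ bX).
  - exact: joins_inside jc eD v1 (sub _ cX).
have sub' : inside ends D' X \subset inside ends D (v |: X).
  by apply: inside_sub; [exact: subsetDl | exact: subsetUr].
have disj : inside ends D' X :&: edges_at ends D v = set0.
  by apply/setP=> e; rewrite inE [e \in inside _ _ _]inE /D' inE in_set0;
    case: (e \in edges_at _ _ _); rewrite ?andbF.
have card3 : #|edges_at ends D v| = 3.
  by rewrite atv setUC cardsU1 cards2 !inE eab negb_or ![ec == _]eq_sym eac ebc.
have := cardsUI (inside ends D' X) (edges_at ends D v); rewrite disj cards0 card3.
have : inside ends D' X :|: edges_at ends D v \subset inside ends D (v |: X).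
  by rewrite subUset sub'.
move/subset_leq_card; have X0 : (0 < #|X|)%N by apply/card_gt0P; exists a.
have := spD.2 (v |: X); rewrite cardsU1 vX /= => /(_ X0).
by move: tX; rewrite /tight; clear; lia.
Qed.

Let tightU (X Y : {set W}) :
  (1 < #|X :&: Y|)%N -> tight X -> tight Y -> tight (X :|: Y).
Proof.
move=> XY1; rewrite /tight; have := spD'.2 _ XY1.
by have := inside_UI ends D' X Y; have := cardsUI X Y; clear; lia.
Qed.

(** Otherwise each pair of neighbours lies in a tight set. If two of these sets share two vertices,
    their union is tight and contains [a], [b], [c]. If not, they share no edges and meet pairwise
    in single vertices, and adding the three counts makes their union tight. Both contradict
    [not_tight3]. *)
Lemma one_extension_inverse :
  [\/ (forall X : {set W}, a \in X -> b \in X -> (#|inside ends D' X| + 4 <= 2 * #|X|)%N),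
      (forall X : {set W}, b \in X -> c \in X -> (#|inside ends D' X| + 4 <= 2 * #|X|)%N)
    | (forall X : {set W}, a \in X -> c \in X -> (#|inside ends D' X| + 4 <= 2 * #|X|)%N)].
Proof.
have ex_tight x y : ~ (forall X : {set W}, x \in X -> y \in X ->
      (#|inside ends D' X| + 4 <= 2 * #|X|)%N) -> exists X : {set W}, [/\ x \in X, y \in X & tight X].
  move=> H; apply: NNPP => nX; apply: H => X xX yX; rewrite leqNgt; apply/negP=> tX.
  by apply: nX; exists X.
apply: NNPP => none.
have [X [aX bX tX]] := ex_tight a b (fun H => none (Or31 _ _ H)).
have [Y [bY cY tY]] := ex_tight b c (fun H => none (Or32 _ _ H)).
have [Z [aZ cZ tZ]] := ex_tight a c (fun H => none (Or33 _ _ H)).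
have small A B : tight A -> tight B -> a \in A :|: B -> b \in A :|: B -> c \in A :|: B ->
    (#|A :&: B| <= 1)%N.
  move=> tA tB aAB bAB cAB; rewrite leqNgt; apply/negP=> AB1.
  exact: not_tight3 aAB bAB cAB (tightU AB1 tA tB).
have XY : (#|X :&: Y| <= 1)%N by apply: small; rewrite // inE ?aX ?bX ?cY ?orbT.
have XZ : (#|X :&: Z| <= 1)%N by apply: small; rewrite // inE ?aX ?bX ?cZ ?orbT.
have YZ : (#|Y :&: Z| <= 1)%N by apply: small; rewrite // inE ?aZ ?bY ?cZ ?orbT.
apply: (@not_tight3 (X :|: Y :|: Z)); rewrite ?inE ?aX ?bX ?cY ?orbT //.
have XYn : (0 < #|X :&: Y|)%N by apply/card_gt0P; exists b; rewrite inE bX.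
have XYZ : (1 < #|(X :|: Y) :&: Z|)%N by apply: (cardsI_gt1 ac); rewrite ?inE ?aX ?cY ?orbT.
have := cardsUI (X :|: Y) Z; have := cardsUI X Y.
pose i := inside ends D'.
have := cardsUI (i X) (i Y); rewrite inside_small // cards0.
have := cardsUI (i X :|: i Y) (i Z); rewrite setIUl !inside_small // setU0 cards0.
have : i X :|: i Y :|: i Z \subset i (X :|: Y :|: Z).
  by rewrite !subUset !inside_sub // ?subsetUr // -?setUA ?subsetUl // setUCA subsetUl.
by move/subset_leq_card; move: tX tY tZ XYn XYZ; rewrite /tight -/i; clear; lia.
Qed.

End DegreeThree.

(** * Independent frameworks: the theorem of Pollaczek-Geiringer and Laman *)

(** Entry of the rigidity matrix in the row of edge [uv] and the column of coordinate [b] of vertex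
    [u]. *)
Definition rig (F : fieldType) (W : eqType) (p : W -> bool -> F) (uv : W * W)
    (u : W) (b : bool) : F :=
  ((uv.1 == u)%:R - (uv.2 == u)%:R) * (p uv.1 b - p uv.2 b).

(** Vertices outside [U] carry no equation and so act as pins. *)
Definition equilibrium (F : fieldType) (W E : finType) (U : {set W})
    (ends : E -> W * W) (p : W -> bool -> F) (w : E -> F) : Prop :=
  forall u b, u \in U -> \sum_e w e * rig p (ends e) u b = 0.

Definition independent (F : fieldType) (W E : finType) (U : {set W}) (D : {set E})
    (ends : E -> W * W) (p : W -> bool -> F) : Prop :=
  forall w, (forall e, e \notin D -> w e = 0) -> equilibrium U ends p w ->
  forall e, w e = 0.

Lemma independent_line_open (F : fieldType) (W E : finType) (U : {set W})
    (D : {set E}) (ends : E -> W * W) :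
  line_open (@independent F W E U D ends).
Proof.
move=> p d indp.
(* The extra columns force [w] to vanish outside [D]. *)
pose A (q : W -> bool -> F) (s : F) (e : E) (c : W * bool + E) : F :=
  match c with
  | inl ub => (ub.1 \in U)%:R * rig q (ends e) ub.1 ub.2
  | inr e' => s * ((e == e') && (e' \notin D))%:R
  end.
have AP q : rows_free (A q 1) <-> independent U D ends q.
  split=> [freeA w wD weq|indq w kw].
    apply: freeA => -[[u b]|e'] /=.
      case uU: (u \in U); last by rewrite big1 // => e _; rewrite mul0r mulr0.
      by rewrite -[RHS](weq u b uU); apply: eq_bigr => e _; rewrite mul1r.
    apply: big1 => e _; case: eqP => [->|]; last by rewrite mul1r mulr0.
    by case: (boolP (e' \in D)) => [_|/wD ->]; rewrite /= ?mul1r ?mulr0 ?mul0r.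
  apply: indq => [e eD|u b uU].
    have := kw (inr e); rewrite /= (bigD1 e) //= eqxx eD mul1r mulr1 big1 ?addr0 // => e' ne.
    by rewrite (negbTE ne) mul1r mulr0.
  have := kw (inl (u, b)); rewrite /= uU => {2}<-.
  by apply: eq_bigr => e _; rewrite mul1r.
(* The rigidity entries are linear in the placement, while the forcing columns stay constant along
   the line; hence the factor 0 in the direction. *)
have [f [f0 fA]] := rows_free_line (A d 0) ((AP p).2 indp).
exists f; split=> // t /fA freeA; apply/AP; congr (rows_free _): freeA.
apply: functional_extensionality => e; apply: functional_extensionality => -[[u b]|e'] /=.
  by rewrite /rig /move; ring.
by rewrite mul0r mulr0 addr0.
Qed.

Lemma rig_joins (F : fieldType) (W : eqType) (p : W -> bool -> F) (uv : W * W)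
    (v a u : W) (b : bool) :
  joins uv v a -> rig p uv u b = rig p (v, a) u b.
Proof. by case=> ->; rewrite /rig /=; ring. Qed.

Lemma rig_away (F : fieldType) (W : eqType) (p : W -> bool -> F) (uv : W * W)
    (u : W) (b : bool) :
  uv.1 != u -> uv.2 != u -> rig p uv u b = 0.
Proof. by rewrite /rig => /negbTE -> /negbTE ->; rewrite subrr mul0r. Qed.

Definition place (F : fieldType) (W : eqType) (p : W -> bool -> F) (v : W)
    (q : bool -> F) : W -> bool -> F :=
  fun u => if u == v then q else p u.

Lemma rig_place (F : fieldType) (W : eqType) (p : W -> bool -> F) (v : W)
    (q : bool -> F) (uv : W * W) (u : W) (b : bool) :
  uv.1 != v -> uv.2 != v -> rig (place p v q) uv u b = rig p uv u b.
Proof. by rewrite /rig /place => /negbTE -> /negbTE ->. Qed.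

Lemma edges_atC (W E : finType) (ends : E -> W * W) (D : {set E}) (v : W) (e : E) :
  e \in D -> e \notin edges_at ends D v -> ((ends e).1 != v) /\ ((ends e).2 != v).
Proof. by rewrite inE => -> /=; rewrite negb_or => /andP. Qed.

Lemma sum_edges_at (F : fieldType) (W E : finType) (ends : E -> W * W) (D : {set E})
    (v : W) (p : W -> bool -> F) (w : E -> F) (b : bool) :
  (forall e, e \notin D -> w e = 0) ->
  \sum_e w e * rig p (ends e) v b
  = \sum_(e in edges_at ends D v) w e * rig p (ends e) v b.
Proof.
move=> wD; rewrite [RHS]big_mkcond; apply: eq_bigr => e _; case: ifP => // /negbT eN.
have [eD|/wD ->] := boolP (e \in D); last by rewrite mul0r.
by have [e1 e2] := edges_atC eD eN; rewrite rig_away ?mulr0.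
Qed.

(** Equilibrium at [v] alone kills the stress on its edges; the remaining edges do not see where [v]
    is placed. *)
Lemma independent_extend (F : fieldType) (W E : finType) (ends : E -> W * W)
    (D : {set E}) (v : W) (p : W -> bool -> F) (q : bool -> F) :
  independent [set: W] (D :\: edges_at ends D v) ends p ->
  (forall w : E -> F,
    (forall b, \sum_(e in edges_at ends D v) w e * rig (place p v q) (ends e) v b = 0) ->
    forall e, e \in edges_at ends D v -> w e = 0) ->
  independent [set: W] D ends (place p v q).
Proof.
move=> indp free_v w wD weq.
have wv : forall e, e \in edges_at ends D v -> w e = 0.
  by apply: free_v => b; rewrite -sum_edges_at // weq ?inE.
have wD' e : e \notin D :\: edges_at ends D v -> w e = 0.
  by rewrite inE negb_and negbK => /orP[/wv|/wD].
apply: indp => // u b _; rewrite -[RHS](weq u b (in_setT _)); apply: eq_bigr => e _.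
have [|/wD' ->] := boolP (e \in D :\: edges_at ends D v); last by rewrite !mul0r.
by case/setDP=> eD /(edges_atC eD)[e1 e2]; rewrite rig_place.
Qed.

Lemma independent_generic (F : numFieldType) (W E : finType) (U : {set W})
    (D : {set E}) (ends : E -> W * W) (Q : (W -> bool -> F) -> Prop) :
  line_open Q -> ex Q -> (exists p : W -> bool -> F, independent U D ends p) ->
  exists p : W -> bool -> F, independent U D ends p /\ Q p.
Proof.
by move=> openQ exQ ind; apply: line_open_meet => //; apply: independent_line_open.
Qed.

(** * Henneberg extensions and the induction *)

Lemma neq_generic (F : numFieldType) (W : eqType) (x y : W) :
  x != y -> exists p : W -> bool -> F, p x <> p y.
Proof.
move=> xy; exists (fun v _ => (v == x)%:R) => /(congr1 (fun h => h true)) /eqP.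
by rewrite eqxx [y == x]eq_sym (negbTE xy) oner_eq0.
Qed.

Lemma zero_extension (F : realFieldType) (W E : finType) (ends : E -> W * W)
    (D : {set E}) (v : W) :
  sparse ends D -> (0 < #|edges_at ends D v| <= 2)%N ->
  (exists p : W -> bool -> F, independent [set: W] (D :\: edges_at ends D v) ends p) ->
  exists p : W -> bool -> F, independent [set: W] D ends p.
Proof.
move=> spD /andP[/card_gt0P[e1 e1v] deg2] exp.
have [x jx xv] := joins_endpoint spD e1v.
have e1D : e1 \in D by move: e1v; rewrite inE => /andP[].
have [e2v|no2] := pickP (mem (edges_at ends D v :\ e1)).
  move=> /setD1P[e21 e2at].
  have [y jy yv] := joins_endpoint spD e2at.
  have e2D : e2v \in D by move: e2at; rewrite inE => /andP[].
  have xy : x != y.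
    by apply: (sparse_simple spD e1D e2D _ xv jx jy); rewrite eq_sym.
  have [p [indp pxy]] := independent_generic (@neq_line_open _ _ x y) (neq_generic F xy) exp.
  have atv : edges_at ends D v = [set e1; e2v].
    apply/esym/eqP; rewrite eqEcard cards2 [e1 == _]eq_sym e21 deg2 andbT.
    by apply/subsetP=> e /set2P[]->.
  (* Quarter turn of [y - x] about [x]. *)
  pose q b := if b then p x true - (p y false - p x false)
              else p x false + (p y true - p x true).
  exists (place p v q); apply: independent_extend => // w.
  rewrite atv => weq.
  have {weq} weq b : w e1 * (q b - p x b) + w e2v * (q b - p y b) = 0.
    rewrite -[RHS](weq b) big_setU1 ?inE 1?eq_sym ?e21 // big_set1.
    rewrite (rig_joins _ _ _ jx) (rig_joins _ _ _ jy) /rig /place /= !eqxx.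
    by rewrite (negbTE xv) (negbTE yv) subr0 !mul1r.
  (* The dot product of the equilibrium at [v] with [y - x] isolates [w e2v], then the cross product
     isolates [w e1], each with factor [n] up to sign. *)
  pose n := (p y true - p x true) ^+ 2 + (p y false - p x false) ^+ 2.
  have n0 : n != 0.
    rewrite paddr_eq0 ?sqr_ge0 // !sqrf_eq0 !subr_eq0; apply/negP=> /andP[/eqP pt /eqP pf].
    by apply: pxy; apply: functional_extensionality => -[].
  have wt := weq true; have wf := weq false; rewrite /q in wt wf.
  have w2 : w e2v = 0.
    apply/(mulIf n0); rewrite mul0r /n.
    transitivity (- ((p y true - p x true) * (w e1 * (p x true - (p y false - p x false) - p x true) +
       w e2v * (p x true - (p y false - p x false) - p y true)) +
      (p y false - p x false) * (w e1 * (p x false + (p y true - p x true) - p x false) +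
       w e2v * (p x false + (p y true - p x true) - p y false)))); first by ring.
    by rewrite wt wf; ring.
  have w1 : w e1 = 0.
    rewrite w2 in wt wf; apply/(mulIf n0); rewrite mul0r /n.
    transitivity ((p y true - p x true) *
       (w e1 * (p x false + (p y true - p x true) - p x false) + 0) -
      (p y false - p x false) * (w e1 * (p x true - (p y false - p x false) - p x true) + 0));
      first by ring.
    by rewrite -[X in _ * X - _]addr0; move: wt wf; rewrite !mul0r => -> ->; ring.
  by move=> e /set2P[]->.
have atv : edges_at ends D v = [set e1].
  apply/eqP; rewrite eqEsubset sub1set e1v andbT; apply/subsetP=> e ev.
  by have := no2 e; rewrite !inE /= in ev *; rewrite ev andbT => /negbFE.
have [p indp] := exp.
(* At degree one it suffices to place [v] off its neighbour [x]. *)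
exists (place p v (fun b => p x b + 1)); apply: independent_extend => // w.
rewrite atv => weq e /set1P->; have := weq true.
rewrite big_set1 (rig_joins _ _ _ jx) /rig /place /= !eqxx (negbTE xv) subr0 mul1r.
by rewrite addrC addKr mulr1.
Qed.

(** The new edge of a reduction reuses the name of a deleted one, so the edge type stays fixed
    during the induction. *)
Definition redirect (W : Type) (E : eqType) (ends : E -> W * W) (e0 : E) (uv : W * W) :
    E -> W * W :=
  fun e => if e == e0 then uv else ends e.

(** A set containing [a] and [b] gains at most the edge [ea], for which [noX] leaves room; any other
    set induces only old edges. *)
Lemma sparse_redirect (W E : finType) (ends : E -> W * W) (D : {set E}) (v a b : W)
    (ea eb ec : E) :
  sparse ends D -> edges_at ends D v = [set ea; eb; ec] ->
  a != b -> ea != eb -> ea != ec ->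
  (forall X : {set W}, a \in X -> b \in X ->
    (#|inside ends (D :\: edges_at ends D v) X| + 4 <= 2 * #|X|)%N) ->
  sparse (redirect ends ea (a, b)) (D :\: [set eb; ec]).
Proof.
move=> spD atv ab eab eac noX; split=> [e|X X1].
  by rewrite /redirect => /setDP[eD _]; case: ifP => // _; apply: spD.1.
have [/andP[aX bX]|abX] := boolP ((a \in X) && (b \in X)).
  apply: leq_trans (noX X aX bX).
  set Y := inside _ (D :\: edges_at _ _ _) X.
  suff : inside (redirect ends ea (a, b)) (D :\: [set eb; ec]) X \subset ea |: Y.
    by move/subset_leq_card; rewrite cardsU1; case: (_ \notin _); lia.
  apply/subsetP=> e; rewrite [e \in inside _ _ _]inE /redirect [e \in ea |: Y]inE in_set1.
  case: eqP => //= /eqP ne /andP[/setDP[eD nbc] eX]; rewrite inE eX andbT inE eD atv andbT.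
  by move: nbc; rewrite !inE (negbTE ne).
apply: leq_trans (spD.2 X X1); rewrite leq_add2r subset_leq_card //.
apply/subsetP=> e; rewrite !inE /redirect.
case: (e =P ea) => [_|_ /andP[/andP[_ ->] ->]] //=.
by rewrite (negbTE abX) andbF.
Qed.

Lemma one_extension (F : realFieldType) (W E : finType) (ends : E -> W * W)
    (D : {set E}) (v a b c : W) (ea eb ec : E) :
  edges_at ends D v = [set ea; eb; ec] ->
  joins (ends ea) v a -> joins (ends eb) v b -> joins (ends ec) v c ->
  a != b -> b != c -> a != c -> a != v -> b != v -> c != v ->
  ea != eb -> eb != ec -> ea != ec ->
  (exists p : W -> bool -> F,
    independent [set: W] (D :\: [set eb; ec]) (redirect ends ea (a, b)) p) ->
  exists p : W -> bool -> F, independent [set: W] D ends p.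
Proof.
move=> atv ja jb jc ab bc ac av bv cv eab ebc eac exp.
have [p [indp pabc]] := independent_generic (@cross_line_open _ _ a b c)
  (cross_generic F ab ac bc) exp.
(* With [v] at the midpoint of [a] and [b], the edges [va], [vb] act as the edge [ab]. *)
pose q x := (p a x + p b x) / 2.
exists (place p v q) => w wD weq.
have split3 (g : E -> F) : \sum_e g e =
    g ea + g eb + g ec + \sum_(e | e \notin edges_at ends D v) g e.
  rewrite (bigID (mem (edges_at ends D v))) /=; congr (_ + _).
  rewrite atv -setUA big_setU1 ?inE ?negb_or ?eab ?eac //=.
  by rewrite big_setU1 ?inE //= big_set1 addrA.
have at_v x : w ea * (q x - p a x) + w eb * (q x - p b x) + w ec * (q x - p c x) = 0.
  have := weq v x (in_setT _); rewrite split3 big1 ?addr0.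
    rewrite (rig_joins _ _ _ ja) (rig_joins _ _ _ jb) (rig_joins _ _ _ jc) /rig /place /=.
    by rewrite eqxx (negbTE av) (negbTE bv) (negbTE cv) subr0 !mul1r.
  move=> e eN; have [eD|/wD ->] := boolP (e \in D); last by rewrite mul0r.
  by have [e1 e2] := edges_atC eD eN; rewrite rig_away ?mulr0.
(* The edges to [a] and [b] are both parallel to [b - a], so the cross product with [b - a] leaves
   only the edge to [c], which is transverse to it. *)
have wc : w ec = 0.
  apply/(mulIf pabc); rewrite mul0r /cross.
  transitivity ((p b false - p a false) *
     (w ea * (q true - p a true) + w eb * (q true - p b true) + w ec * (q true - p c true)) -
    (p b true - p a true) *
     (w ea * (q false - p a false) + w eb * (q false - p b false)
      + w ec * (q false - p c false))); last by rewrite !at_v; ring.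
  by rewrite /q; field.
have wab : w ea = w eb.
  apply/eqP; rewrite -subr_eq0; apply/eqP/(mulIf pabc); rewrite mul0r /cross.
  transitivity (2 * ((p c false - p a false) *
     (w ea * (q true - p a true) + w eb * (q true - p b true) + w ec * (q true - p c true)) -
    (p c true - p a true) *
     (w ea * (q false - p a false) + w eb * (q false - p b false)
      + w ec * (q false - p c false)))); last by rewrite !at_v; ring.
  by rewrite wc /q; field.
(* The edge from [a] to the midpoint is half of [ab], so stress [w ea / 2] on [ab] exerts the same
   forces on [a] and [b]. *)
pose w' e := if e == eb then 0 else if e == ea then w ea / 2 else w e.
have w'0 : forall e, w' e = 0.
  apply: indp => [e|u x _].
    rewrite /w' !inE negb_and negbK; case: (e == eb) => //=.
    case: (e =P ec) => [-> _|_ /= eD]; first by rewrite eq_sym (negbTE eac).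
    case: eqP => [ee|_]; last exact: wD.
    by rewrite -ee (wD _ eD) mul0r.
  rewrite -[RHS](weq u x (in_setT _)) !split3; congr (_ + _).
    rewrite /w' !eqxx (negbTE eab) ![ec == _]eq_sym (negbTE ebc) (negbTE eac) wc.
    rewrite (rig_joins _ _ _ ja) (rig_joins _ _ _ jb) -wab /redirect eqxx /rig /place /=.
    by rewrite eqxx (negbTE av) (negbTE bv) /q; field.
  apply: eq_bigr => e eN; rewrite /w' /redirect.
  have nea : e == ea = false by apply: contraNF eN => /eqP->; rewrite atv !inE eqxx.
  have neb : e == eb = false by apply: contraNF eN => /eqP->; rewrite atv !inE eqxx orbT.
  rewrite nea neb; have [eD|/wD ->] := boolP (e \in D); last by rewrite !mul0r.
  by have [e1 e2] := edges_atC eD eN; rewrite rig_place.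
have wa : w ea = 0.
  have := w'0 ea; rewrite /w' (negbTE eab) eqxx => /eqP.
  by rewrite mulf_eq0 invr_eq0 pnatr_eq0 orbF => /eqP.
move=> e; have := w'0 e; rewrite /w'; case: eqP => [-> _|_]; first by rewrite -wab.
by case: eqP => [->|].
Qed.

(** Henneberg induction on the number of edges: a vertex of degree at most two is stripped of its
    edges, and one of degree three has them replaced by a single edge between two neighbours. The
    endpoint map is generalized because this replacement changes it. *)
Theorem sparse_independent (F : realFieldType) (W E : finType) (ends : E -> W * W)
    (D : {set E}) :
  sparse ends D -> exists p : W -> bool -> F, independent [set: W] D ends p.
Proof.
elim: {D}#|D| {-2}D (leqnn #|D|) ends => [|n IHn] D.
  rewrite leqn0 cards_eq0 => /eqP-> ends _; exists (fun _ _ => 0) => w wD _ e.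
  by apply: wD; rewrite inE.
move=> Dn ends spD; have [->|D0] := eqVneq D set0.
  by exists (fun _ _ => 0) => w wD _ e; apply: wD; rewrite inE.
have [v /andP[v0 v3]] := low_degree_vertex spD D0.
have inD : edges_at ends D v \subset D by apply/subsetP=> e; rewrite inE => /andP[].
have [v2|v2] := leqP #|edges_at ends D v| 2.
  apply: (zero_extension spD (v := v)); first by rewrite v0.
  apply: IHn; last by apply: sparse_sub spD; apply: subsetDl.
  by have := cardsD D (edges_at ends D v); rewrite (setIidPr inD); lia.
have [ea [eb [ec [[eav ebv ecv] [eab ebc eca]]]]] := card_gt2P v2.
have eac : ea != ec by rewrite eq_sym.
have atv : edges_at ends D v = [set ea; eb; ec].
  apply/esym/eqP; rewrite eqEcard setUC cardsU1 cards2 !inE negb_or eca eab [ec == eb]eq_sym ebc.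
  by rewrite v3 andbT; apply/subsetP=> e /setUP[/set1P->|/set2P[]->].
have [a ja av] := joins_endpoint spD eav.
have [b jb bv] := joins_endpoint spD ebv.
have [c jc cv] := joins_endpoint spD ecv.
have [eaD ebD ecD] := And3 (subsetP inD _ eav) (subsetP inD _ ebv) (subsetP inD _ ecv).
have ab := sparse_simple spD eaD ebD eab av ja jb.
have bc := sparse_simple spD ebD ecD ebc bv jb jc.
have ac := sparse_simple spD eaD ecD eac av ja jc.
(* The three outcomes of [one_extension_inverse] differ by a permutation of the neighbours. *)
have ext x y z ex ey ez :
    edges_at ends D v = [set ex; ey; ez] ->
    joins (ends ex) v x -> joins (ends ey) v y -> joins (ends ez) v z ->
    x != y -> y != z -> x != z -> x != v -> y != v -> z != v ->
    ex != ey -> ey != ez -> ex != ez -> ey \in D ->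
    (forall X : {set W}, x \in X -> y \in X ->
      (#|inside ends (D :\: edges_at ends D v) X| + 4 <= 2 * #|X|)%N) ->
    exists p : W -> bool -> F, independent [set: W] D ends p.
  move=> atv' jx jy jz xy yz xz xv yv zv exy eyz exz eyD noX.
  apply: (one_extension atv' jx jy jz) => //.
  apply: IHn (sparse_redirect spD atv' xy exy exz noX).
  have : D :\: [set ey; ez] \subset D :\ ey.
    by apply/subsetP=> e; rewrite !inE negb_or -andbA => /and3P[-> _ ->].
  by move/subset_leq_card; move: Dn; rewrite (cardsD1 ey D) eyD; clear; lia.
have [noX|noX|noX] := one_extension_inverse spD atv ja jb jc ab ac av bv eab ebc eac.
- exact: (ext a b c ea eb ec).
- apply: (ext b c a eb ec ea _ jb jc ja bc _ _ bv cv av ebc eca _ ecD noX);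
    by [rewrite atv -setUA setUC | rewrite eq_sym].
- apply: (ext a c b ea ec eb _ ja jc jb ac _ ab av cv bv eac _ eab ecD noX);
    by [rewrite atv setUAC | rewrite eq_sym].
Qed.

(** * Pinned frameworks and their collapse *)

(** Subtracting the multiple of [w0] that agrees with [w] at [e0] leaves a stress supported off
    [e0], which must vanish. *)
Lemma independent_kernel_line (F : fieldType) (W E : finType) (U : {set W})
    (ends : E -> W * W) (p : W -> bool -> F) (w0 w : E -> F) (e0 : E) :
  (forall e, independent U (~: [set e]) ends p) ->
  equilibrium U ends p w0 -> equilibrium U ends p w -> w0 e0 != 0 ->
  forall e, w e = w e0 / w0 e0 * w0 e.
Proof.
move=> indp eq0 eqw we0 e; apply/eqP; rewrite -subr_eq0; apply/eqP.
apply: (indp e0 (fun e => w e - w e0 / w0 e0 * w0 e)) => [f|u b uU].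
  by rewrite !inE negbK => /eqP->; rewrite divfK ?subrr.
transitivity (\sum_e w e * rig p (ends e) u b
              - w e0 / w0 e0 * \sum_e w0 e * rig p (ends e) u b).
  by rewrite mulr_sumr -sumrB; apply: eq_bigr => f _; rewrite mulrBl -!mulrA.
by rewrite eq0 // eqw // mulr0 subr0.
Qed.

(** Every edge set avoiding [e] is proper, so the circuit count applies to it; a loop alone would
    span one vertex and violate that count. *)
Lemma circuit_sparse (W E : finType) (ends : E -> W * W) (e : E) :
  rigidity_circuit ends -> sparse ends (~: [set e]).
Proof.
case=> _ circ.
have spanS (G : {set E}) (X : {set W}) :
    (forall f, f \in G -> ((ends f).1 \in X) && ((ends f).2 \in X)) ->
    (#|span_of ends G| <= #|X|)%N.
  move=> GX; apply: subset_leq_card; apply/subsetP=> u; rewrite inE.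
  by case/exists_inP=> f /GX/andP[f1 f2] /orP[]/eqP <-.
have count (G : {set E}) : G \subset ~: [set e] -> G != set0 ->
    (#|G| + 3 <= 2 * #|span_of ends G|)%N.
  move=> Ge G0; apply: circ => //; rewrite properT; apply/eqP=> GT.
  by have := subsetP Ge e; rewrite GT !inE eqxx => /(_ isT).
split=> [f fe|X X1].
  apply/eqP=> loop.
  have := count [set f]; rewrite sub1set cards1 => /(_ fe).
  have -> : [set f] != set0 by apply/set0Pn; exists f; rewrite inE.
  have : (#|span_of ends [set f]| <= #|[set (ends f).1]|)%N.
    by apply: spanS => g /set1P->; rewrite -loop !inE eqxx.
  by rewrite cards1 => le1 /(_ isT); lia.
have [->|G0] := eqVneq (inside ends (~: [set e]) X) set0; first by rewrite cards0; lia.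
apply: leq_trans (count _ _ G0) _.
  by apply/subsetP=> f; rewrite inE => /andP[].
by rewrite leq_mul2l spanS // => f; rewrite inE => /andP[].
Qed.

Lemma sum_rig (F : fieldType) (W : finType) (p : W -> bool -> F) (uv : W * W) (b : bool) :
  \sum_u rig p uv u b = 0.
Proof.
rewrite -mulr_suml sumrB.
have one x : \sum_u (x == u)%:R = 1 :> F.
  by rewrite (bigD1 x) //= eqxx big1 ?addr0 // => u; rewrite eq_sym => /negbTE->.
by rewrite !one subrr mul0r.
Qed.

Lemma collapse_eq (V : finType) (P : {set V}) (x : V) (s : {v : V | v \notin P}) :
  (collapse P x == Some s) = (x == val s).
Proof.
rewrite /collapse; case: insubP => [s' _ <-|xP]; first exact: val_eqE.
by apply/esym/negbTE; apply: contraNneq xP => ->; exact: (valP s).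
Qed.

(** The forces of any stress sum to zero over all vertices, so equilibrium at the inner vertices
    forces it at the merged vertex [None] too. *)
Lemma independent_collapse (F : fieldType) (V E : finType) (P : {set V})
    (ends : E -> V * V) (D : {set E}) (pos : star_vertex P -> bool -> F) :
  independent [set: star_vertex P] D (star_ends P ends) pos ->
  independent (~: P) D ends (fun v => pos (collapse P v)).
Proof.
move=> ind w wD weq; apply: ind => // u b _.
have inner s : \sum_e w e * rig pos (star_ends P ends e) (Some s) b = 0.
  rewrite -[RHS](weq (val s) b); last by rewrite inE (valP s).
  by apply: eq_bigr => e _; rewrite /rig /= !collapse_eq.
case: u => [s|]; first exact: inner.
have total : \sum_u \sum_e w e * rig pos (star_ends P ends e) u b = 0.
  rewrite exchange_big big1 //= => e _.
  by rewrite -mulr_sumr sum_rig mulr0.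
rewrite -[RHS]total (bigD1 None) //= [X in _ + X]big1 ?addr0 // => -[s _|//].
exact: inner.
Qed.

Definition quarter_turn (F : fieldType) (V : Type) (m : V -> bool -> F) : V -> bool -> F :=
  fun v b => if b then - m v false else m v true.

(** The rotation only swaps the two columns of each vertex, up to sign. *)
Lemma independent_quarter_turn (F : fieldType) (V E : finType) (U : {set V})
    (D : {set E}) (ends : E -> V * V) (m : V -> bool -> F) :
  independent U D ends m -> independent U D ends (quarter_turn m).
Proof.
move=> ind w wD weq; apply: ind => // u b uU; case: b.
  by rewrite -[RHS](weq u false uU).
have := weq u true uU; rewrite /rig /= => sum0.
apply/eqP; rewrite -oppr_eq0 -sumrN; apply/eqP; rewrite -[RHS]sum0.
by apply: eq_bigr => e _; rewrite /quarter_turn /=; ring.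
Qed.

Lemma independent_translate (F : fieldType) (V E : finType) (U : {set V})
    (D : {set E}) (ends : E -> V * V) (m : V -> bool -> F) (o : bool -> F) :
  independent U D ends m -> independent U D ends (fun v b => m v b - o b).
Proof.
move=> ind w wD weq; apply: ind => // u b uU; rewrite -[RHS](weq u b uU).
by apply: eq_bigr => e _; rewrite /rig; ring.
Qed.

(** * The pinned rigidity matrix *)

Definition inner_rig (F : fieldType) (V E : finType) (P : {set V}) (ends : E -> V * V)
    (p : V -> bool -> F) (e : E) (c : {v : V | v \notin P} * bool) : F :=
  rig p (ends e) (val c.1) c.2.

Lemma left_kernel_inner_rig (F : fieldType) (V E : finType) (P : {set V})
    (ends : E -> V * V) (p : V -> bool -> F) (w : E -> F) :
  left_kernel (@inner_rig F V E P ends p) w <-> equilibrium (~: P) ends p w.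
Proof.
split=> [kw u b uP|weq [s b]]; last by apply: weq; rewrite inE (valP s).
rewrite inE in uP; exact: (kw (exist _ u uP, b)).
Qed.

Lemma sum_inner (F : fieldType) (V : finType) (P : {set V}) (f : V -> F) :
  \sum_(s : {v : V | v \notin P}) f (val s) = \sum_(v | v \notin P) f v.
Proof.
pose h : V -> option {v : V | v \notin P} := insub.
rewrite [RHS](reindex_omap val h) => [|v vP]; last by rewrite /h insubT.
by apply: eq_bigl => s; rewrite (valP s) /h valK eqxx.
Qed.

Lemma inner_rig_mul (F : fieldType) (V E : finType) (P : {set V}) (ends : E -> V * V)
    (p h : V -> bool -> F) (e : E) :
  (forall v b, v \in P -> h v b = 0) ->
  \sum_c inner_rig ends p e c * h (val (c : {v : V | v \notin P} * bool).1) c.2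
  = \sum_b (p (ends e).1 b - p (ends e).2 b) * (h (ends e).1 b - h (ends e).2 b).
Proof.
move=> hP; rewrite -(pair_bigA _ (fun s b => inner_rig ends p e (s, b) * h (val s) b)) /=.
rewrite exchange_big; apply: eq_bigr => b _ /=.
rewrite (sum_inner P (fun v => rig p (ends e) v b * h v b)).
have pick x : \sum_(v | v \notin P) (x == v)%:R * h v b = h x b.
  rewrite big_mkcond (bigD1 x) //= big1 => [|v vx].
    by case: ifP => [|/negbFE xP]; rewrite ?eqxx ?mul1r ?addr0 // hP.
  by rewrite eq_sym (negbTE vx) mul0r if_same.
rewrite -(pick (ends e).1) -(pick (ends e).2) -sumrB mulr_sumr.
by apply: eq_bigr => v _; rewrite /rig; ring.
Qed.

Lemma circuit_placement (F : realFieldType) (V E : finType) (P : {set V})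
    (ends : E -> V * V) :
  rigidity_circuit (star_ends P ends) ->
  exists m : V -> bool -> F,
    [/\ forall v b, v \in P -> m v b = 0,
        forall v, v \notin P -> exists b, m v b != 0 &
        forall e, independent (~: P) (~: [set e]) ends m].
Proof.
move=> circ.
pose Q (i : E + {v : V | v \notin P}) (pos : star_vertex P -> bool -> F) : Prop :=
  match i with
  | inl e => independent [set: star_vertex P] (~: [set e]) (star_ends P ends) pos
  | inr s => pos (Some s) <> pos None
  end.
have [pos posQ] : exists pos, forall i, Q i pos.
  apply: line_open_meet_all => -[e|s].
  - exact: independent_line_open.
  - exact: neq_line_open.
  - exact: sparse_independent (circuit_sparse e circ).
  - exact: neq_generic.
(* Translating the merged vertex to the origin lets [m] be read later as velocities with the pins at
   rest. *)
exists (fun v b => pos (collapse P v) b - pos None b); split=> [v b vP|v vP|e].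
- by rewrite /collapse insubF ?subrr // vP.
- apply: NNPP => mv0; apply: (posQ (inr (exist _ v vP))).
  apply: functional_extensionality => b; apply/eqP; rewrite -subr_eq0.
  apply/negPn/negP => mvb; apply: mv0; exists b.
  by rewrite /collapse insubT.
- exact: independent_translate (independent_collapse (posQ (inl e))).
Qed.

(** * Separating the pins *)

Lemma enum_rankR_inj (F : numFieldType) (V : finType) :
  injective (fun v : V => (enum_rank v)%:R : F).
Proof. by move=> u v /eqP; rewrite eqr_nat => /eqP/val_inj/enum_rank_inj. Qed.

(* The pins move in a common direction [s], with distinct speeds [k v]; choosing [s]
   orthogonal to the load of the unique self-stress makes the linear system for the
   velocities of the inner vertices solvable. *)
Lemma separating_motion (F : realFieldType) (V E : finType) (P : {set V})
    (ends : E -> V * V) (m : V -> bool -> F) :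
  (forall e, independent (~: P) (~: [set e]) ends m) ->
  exists q : V -> bool -> F,
    {in P &, forall u v, q u = q v -> u = v} /\
    forall e, \sum_b (m (ends e).1 b - m (ends e).2 b) * (q (ends e).1 b - q (ends e).2 b) = 0.
Proof.
move=> indm.
pose k (v : V) : F := if v \in P then (enum_rank v)%:R else 0.
pose load b (w : E -> F) : F :=
  \sum_e w e * ((m (ends e).1 b - m (ends e).2 b) * (k (ends e).1 - k (ends e).2)).
have [s [s0 s_orth]] : exists s : bool -> F, (exists b, s b != 0) /\
    forall w, equilibrium (~: P) ends m w -> \sum_b s b * load b w = 0.
  have [all0|] := classic (forall w, equilibrium (~: P) ends m w -> load true w = 0).
    exists (fun b => b%:R); split=> [|w /all0 w0]; first by exists true; rewrite oner_neq0.
    by rewrite big_bool /= w0 mulr0 mul0r addr0.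
  move=> /not_all_ex_not[w0] not0; have [eq0 load0] := imply_to_and _ _ not0.
  have [e0 we0] : exists e, w0 e != 0.
    apply: NNPP => w00; apply: load0; apply: big1 => e _.
    have -> : w0 e = 0 by apply/eqP/negPn/negP => we; apply: w00; exists e.
    by rewrite mul0r.
  (* The load of [w0] turned by a right angle; every other stress has a proportional load. *)
  exists (fun b => if b then - load false w0 else load true w0); split.
    by exists false; apply/eqP.
  move=> w eqw; have wE := independent_kernel_line indm eq0 eqw we0.
  have loadE b : load b w = w e0 / w0 e0 * load b w0.
    by rewrite mulr_sumr; apply: eq_bigr => e _; rewrite (wE e) -!mulrA.
  by rewrite big_bool /= !loadE; ring.
pose r v b := k v * s b.
(* The inner velocities [x] must cancel the strain of the pin motion [r]; orthogonality of [s] to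
   all loads is the solvability condition. *)
pose g e := - \sum_b (m (ends e).1 b - m (ends e).2 b) * (r (ends e).1 b - r (ends e).2 b).
have [x xE] : exists x, forall e, \sum_c @inner_rig F V E P ends m e c * x c = g e.
  apply: linear_system_solvable => w /left_kernel_inner_rig/s_orth.
  rewrite big_bool /= => sw; rewrite -[RHS]oppr0 -[X in - X]sw /load !mulr_sumr -big_split /=.
  rewrite -sumrN; apply: eq_bigr => e _.
  by rewrite /g big_bool /= /r; ring.
pose h v b := if insub v is Some s then x (s, b) else 0.
have hP v b : v \in P -> h v b = 0 by move=> vP; rewrite /h insubF // vP.
exists (fun v b => h v b + r v b); split=> [u v uP vP quv|e].
  have [b sb] := s0; move/(congr1 (fun f => f b)): quv.
  rewrite !hP // !add0r /r /k uP vP => /(mulIf sb); exact: enum_rankR_inj.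
have := inner_rig_mul (P := P) ends m e hP.
have -> : \sum_c inner_rig ends m e c * h (val (c : {v : V | v \notin P} * bool).1) c.2 = g e.
  by rewrite -xE; apply: eq_bigr => -[c b] _; rewrite /h valK.
by rewrite /g !big_bool /= => eg; lra.
Qed.

Lemma singular_placement (F : realFieldType) (V E : finType) (P : {set V})
    (ends : E -> V * V) :
  rigidity_circuit (star_ends P ends) ->
  exists p m : V -> bool -> F,
    [/\ {in P &, forall u v, p u = p v -> u = v},
        forall e, independent (~: P) (~: [set e]) ends p,
        forall v b, v \in P -> m v b = 0,
        forall v, v \notin P -> exists b, m v b != 0 &
        forall e, \sum_b (p (ends e).1 b - p (ends e).2 b)
                         * (m (ends e).1 b - m (ends e).2 b) = 0].
Proof.
move=> /(circuit_placement F)[m [mP mI indm]].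
have [q [q_inj qm]] := separating_motion indm.
have [f [f0 fQ]] := line_open_all (s := enum E)
  (fun e => @independent_line_open F V E (~: P) (~: [set e]) ends)
  q (fun e _ => independent_quarter_turn (indm e)).
(* The factor ['X] keeps [t] nonzero: on the pins [m] vanishes, so the placement there is [t q] and
   remains injective. *)
have fX : f * 'X != 0.
  by rewrite mulf_neq0 ?polyX_eq0 //; apply: contraNneq f0 => ->; rewrite horner0.
have [t] := poly_nonroot fX; rewrite hornerM hornerX mulf_eq0 negb_or => /andP[/fQ indt t0].
exists (move (quarter_turn m) q t), m; split=> // [u v uP vP|e|e].
- move=> puv; apply: q_inj => //; apply: functional_extensionality => b.
  move/(congr1 (fun f => f b)): puv; rewrite /move /quarter_turn !mP // oppr0.
  by rewrite !if_same !add0r => /(mulfI t0).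
- by apply: indt; rewrite mem_enum.
- have := qm e; rewrite !big_bool /= /move /quarter_turn => qe.
  set M1 := m _ true - m _ true in qe *; set M2 := m _ false - m _ false in qe *.
  set Q1 := q _ true - q _ true in qe; set Q2 := q _ false - q _ false in qe.
  rewrite -[RHS](mulr0 t) -[X in _ = t * X]qe /M1 /M2 /Q1 /Q2; ring.
Qed.

(** * From matrix kernels to stresses and motions *)

Lemma sum_incident (F : fieldType) (W E : finType) (ends : E -> W * W)
    (p : W -> bool -> F) (w : E -> F) (u : W) (b : bool) :
  (forall e, (ends e).1 != (ends e).2) ->
  \sum_(e | ((ends e).1 == u) || ((ends e).2 == u))
     w e * (p u b - p (other (ends e) u) b)
  = \sum_e w e * rig p (ends e) u b.
Proof.
move=> loopless; rewrite big_mkcond; apply: eq_bigr => e _.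
have := loopless e; rewrite /rig /other; case: (ends e) => x y /= xy.
have [<-|xu] := eqVneq x u; first by rewrite eq_sym (negbTE xy) subr0 mul1r.
by have [<-|yu] := eqVneq y u; rewrite /= ?subrr; ring.
Qed.

Theorem theorem3p2 (V E : finType) (P : {set V}) (ends : E -> V * V)
  (Hassur : assur_graph P ends)
  (HplanarG : planar ends)
  (HplanarGstar : planar (star_ends P ends)) :
  exists p : V -> pt,
    {in P &, injective p} /\
    (exists w : E -> R,
        self_stress P ends p w /\ (forall e, w e <> R0) /\
        (forall w', self_stress P ends p w' -> exists c : R, forall e, w' e = Rmult c (w e))) /\
    (exists m : V -> pt,
        first_order_motion P ends p m /\ (forall v, v \notin P -> m v <> (R0, R0)) /\
        (forall m', first_order_motion P ends p m' ->
           exists c : R, forall v, m' v = (Rmult c (fst (m v)), Rmult c (snd (m v))))).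
Proof.
case: Hassur => pinned [[cardE _] circ].
have loopless e : (ends e).1 != (ends e).2 by case: (pinned e).
have [p [m [p_inj indp mP mI pm]]] := singular_placement R circ.
pose A := @inner_rig R V E P ends p.
have cardEC : #|E| = #|{: {v : V | v \notin P} * bool}|.
  rewrite cardE card_prod card_bool card_sig mulnC; congr (_ * _)%N.
  by apply: eq_card => v; rewrite !inE.
(* Without inner vertices there would be no edges, and the circuit equation would read 2 = 0. The
   vertex makes [m] a nonzero motion. *)
have [v0 v0I] : exists v, v \notin P.
  apply: NNPP => noI; have E0 : #|E| = 0%N.
    rewrite cardE (_ : ~: P = set0) ?cards0 //; apply/setP=> v; rewrite !inE.
    by apply: contra_notF noI => vI; exists v.
  have := circ.1; rewrite E0 (_ : span_of _ _ = set0) ?cards0 //.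
  apply/setP=> u; rewrite !inE; apply/existsP=> -[e].
  by case: (fintype0 e E0).
have kernel (h : V -> bool -> R) : (forall v b, v \in P -> h v b = 0) ->
    (forall e, \sum_b (p (ends e).1 b - p (ends e).2 b) * (h (ends e).1 b - h (ends e).2 b) = 0) ->
    left_kernel (fun c e => A e c) (fun c => h (val c.1) c.2).
  move=> hP ph e; rewrite -[RHS](ph e) -(inner_rig_mul ends p e hP).
  by apply: eq_bigr => c _; rewrite mulrC.
have km := kernel m mP pm.
have [b0 mb0] := mI v0 v0I.
pose c0 : {v : V | v \notin P} * bool := (exist _ v0 v0I, b0).
have [w /left_kernel_inner_rig eqw [e0 we0]] := square_left_kernel (c := c0) cardEC km mb0.
have w_line w' : equilibrium (~: P) ends p w' -> forall e, w' e = w' e0 / w e0 * w e.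
  by move=> eqw'; apply: independent_kernel_line eqw eqw' we0.
have stressP (w' : E -> R) :
    self_stress P ends (fun v => (p v true, p v false)) w' <-> equilibrium (~: P) ends p w'.
  split=> [st u b|eqw' u uP].
    by rewrite inE => /st[st1 st2]; rewrite -sum_incident //; case: b.
  by split; [rewrite -[RHS](eqw' u true) | rewrite -[RHS](eqw' u false)];
    rewrite ?inE // -sum_incident.
have motionP (h : V -> pt) : first_order_motion P ends (fun v => (p v true, p v false)) h ->
    (forall v, v \in P -> h v = (0, 0)) /\
    forall e, \sum_b (p (ends e).1 b - p (ends e).2 b)
      * ((if b then (h (ends e).1).1 else (h (ends e).1).2)
         - (if b then (h (ends e).2).1 else (h (ends e).2).2)) = 0.
  by case=> hP ph; split=> // e; rewrite big_bool /=; exact: ph.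
exists (fun v => (p v true, p v false)); split.
  move=> u v uP vP [pt pf]; apply: p_inj => //; apply: functional_extensionality => -[] //.
split.
  exists w; split; first exact/stressP.
  split=> [e we|w' /stressP eqw']; last by exists (w' e0 / w e0); apply: w_line.
  (* A stress vanishing at one edge is supported on an independent set of rows, so it would vanish
     at [e0] as well. *)
  case/eqP: we0; apply: (indp e) => // f; rewrite !inE negbK => /eqP->; exact: we.
exists (fun v => (m v true, m v false)); split.
  split=> [v vP|e]; first by rewrite !mP.
  by have := pm e; rewrite big_bool.
split=> [v vI [mt mf]|h /motionP[hP ph]].
  by have [[]] := mI v vI; rewrite ?mt ?mf eqxx.
pose h' v b := if b then (h v).1 else (h v).2.
have h'P v b : v \in P -> h' v b = 0 by move=> /hP hv; rewrite /h' hv; case: b.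
have [k hk] : exists k, forall c : {v : V | v \notin P} * bool,
    h' (val c.1) c.2 = k * m (val c.1) c.2.
  apply: (square_right_kernel (w0 := w) cardEC _ (c := c0) km (kernel h' h'P ph) mb0).
  by move=> w' /left_kernel_inner_rig eqw'; exists (w' e0 / w e0); apply: w_line.
exists k => v; have [vP|vI] := boolP (v \in P).
  by rewrite hP // !mP //; congr pair; exact: (esym (mulr0 k)).
have := hk (exist _ v vI, true); have := hk (exist _ v vI, false).
by rewrite /h' /=; case: (h v) => x y /= -> ->.
Qed.
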